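(* Let $p$ be an odd prime, $n$ a positive integer, and $F(x)=x^{p^n-2}$ over $\mathbb{F}_{p^n}$. Let $c\in\mathbb{F}_{p^n}$ with $c\notin\{0,1,4,4^{-1}\}$. Then the $c$-differential spectrum $\mathbb S$ of $F$ is as follows. (i) $\mathbb S=\{{}_c\omega_0=\frac{p^n-3}{2},{}_c\omega_1=3,{}_c\omega_2=\frac{p^n-3}{2}\}$ if $\chi(c^2-4c)=\chi(1-4c)=-1$ and $\chi(c)=-1$; (ii) $\mathbb S=\{{}_c\omega_0=\frac{p^n-5}{2},{}_c\omega_1=5,{}_c\omega_2=\frac{p^n-5}{2}\}$ if $\chi(c^2-4c)=\chi(1-4c)=-1$ and $\chi(c)=1$; (iii) $\mathbb S=\{{}_c\omega_0=\frac{p^n-1}{2},{}_c\omega_1=2,{}_c\omega_2=\frac{p^n-5}{2},{}_c\omega_3=1\}$ if $\chi(c^2-4c)\chi(1-4c)=-1$ and $\chi(c)=-1$; (iv) $\mathbb S=\{{}_c\omega_0=\frac{p^n-3}{2},{}_c\omega_1=4,{}_c\omega_2=\frac{p^n-7}{2},{}_c\omega_3=1\}$ if $\chi(c^2-4c)\chi(1-4c)=-1$ and $\chi(c)=1$; (v) $\mathbb S=\{{}_c\omega_0=\frac{p^n+1}{2},{}_c\omega_1=1,{}_c\omega_2=\frac{p^n-7}{2},{}_c\omega_3=2\}$ if $\chi(c^2-4c)=\chi(1-4c)=1$ and $\chi(c)=-1$; (vi) $\mathbb S=\{{}_c\omega_0=\frac{p^n-1}{2},{}_c\omega_1=3,{}_c\omega_2=\frac{p^n-9}{2},{}_c\omega_3=2\}$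 if $\chi(c^2-4c)=\chi(1-4c)=1$ and $\chi(c)=1$.
   Context: $\chi$ is the quadratic character of $\mathbb{F}_{p^n}$: $\chi(0)=0$, $\chi(x)=1$ for nonzero squares and $\chi(x)=-1$ for nonsquares. For a power function $F(x)=x^d$ over $\mathbb{F}_q$ and $c\in\mathbb{F}_q$, put ${}_c\delta_F(1,b)=\#\{x\in\mathbb{F}_q : F(x+1)-cF(x)=b\}$ and ${}_c\omega_i=\#\{b\in\mathbb{F}_q : {}_c\delta_F(1,b)=i\}$. Saying that the $c$-differential spectrum is $\mathbb S=\{{}_c\omega_{i}=v_{i},\dots\}$ means that the listed ${}_c\omega_i$ have the listed values (possibly $0$ for small parameters) and ${}_c\omega_j=0$ for every $j$ not listed. *)

(* Defs.v *)
From mathcomp Require Import all_boot all_order all_algebra.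

Set Implicit Arguments.
Unset Strict Implicit.
Unset Printing Implicit Defensive.

Import GRing.Theory.
Local Open Scope ring_scope.

Definition quad_char (F : finFieldType) (x : F) : int :=
  if x == 0 then 0 else if [exists y : F, x == y ^+ 2] then 1 else -1.

Definition cdelta (F : finFieldType) (f : F -> F) (c a b : F) : nat :=
  #|[set x : F | f (x + a) - c * f x == b]|.

(* The derivative direction is fixed to [a = 1]; this is the convention for
   power functions, to which the spectrum below is meant to be applied. *)
Definition comega (F : finFieldType) (f : F -> F) (c : F) (i : nat) : nat :=
  #|[set b : F | cdelta f c 1 b == i]|.

(* [s] lists pairs (i, omega_i). Values are rationals so that (q - k) / 2 is
   neither truncated nor rounded. *)
Definition has_cspectrum (F : finFieldType) (f : F -> F) (c : F)
    (s : seq (nat * rat)) : Prop :=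
  (forall (i : nat) (v : rat), (i, v) \in s -> (comega f c i)%:R = v) /\
  (forall j : nat, j \notin unzip1 s -> comega f c j = 0%N).

(* Main.v *)
Require Import Defs.
From mathcomp Require Import all_boot all_order all_algebra.
From mathcomp Require Import finfield ring lra zify.

(* Away from the exceptional points x = 0 and x = -1, which only contribute one
   solution each to b = 1 and b = c, the equation 1/(x+1) - c/x = b is the
   quadratic b x^2 + (b+c-1) x + c = 0, of discriminant (b-c-1)^2 - 4c. Hence
   omega_1 is the number of zeros of the discriminant, corrected at b = 0, 1, c,
   and omega_3 can only come from b = 1 and b = c. No character sum is needed for the rest:
   the omega_i and the i * omega_i both sum to q, which fixes omega_0 and
   omega_2. *)

Import GRing.Theory.
Local Open Scope ring_scope.

(** * Counting identities for c-differential spectra *)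

Lemma eq_cdelta (F : finFieldType) (f g : F -> F) (c a b : F) :
  f =1 g -> cdelta f c a b = cdelta g c a b.
Proof. by move=> fg; apply: eq_card => x; rewrite !inE !fg. Qed.

Lemma sum_cdelta (F : finFieldType) (f : F -> F) (c a : F) :
  (\sum_b cdelta f c a b = #|F|)%N.
Proof.
rewrite -[RHS]sum1_card [RHS](partition_big (fun x => f (x + a) - c * f x) predT) //=.
by apply: eq_bigr => b _; rewrite /cdelta -sum1_card; apply: eq_bigl => x; rewrite inE.
Qed.

Lemma comegaE (F : finFieldType) (f : F -> F) (c : F) (i : nat) :
  comega f c i = (\sum_b (cdelta f c 1%R b == i))%N.
Proof.
rewrite /comega -sum1dep_card [LHS]big_mkcond /=.
by apply: eq_bigr => b _; case: eqP.
Qed.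

(** Both identities hold term by term in [b]: exactly one of the four indicators is 1, and weighted
    by their indices they add up to [cdelta f c 1 b], whose total is [sum_cdelta]. *)
Lemma comega_sums (F : finFieldType) (f : F -> F) (c : F) :
    (forall b, (cdelta f c 1%R b <= 3)%N) ->
  (comega f c 0 + comega f c 1 + comega f c 2 + comega f c 3)%N = #|F| /\
  (comega f c 1 + 2 * comega f c 2 + 3 * comega f c 3)%N = #|F|.
Proof.
move=> le3; rewrite !comegaE !big_distrr /= -!big_split /=; split.
  rewrite -sum1_card; apply: eq_bigr => b _.
  by case: (cdelta f c 1 b) (le3 b) => [|[|[|[|]]]].
rewrite -[RHS](sum_cdelta F f c 1); apply: eq_bigr => b _.
by case: (cdelta f c 1 b) (le3 b) => [|[|[|[|]]]].
Qed.

(** Lets the spectra without an entry for 3 be derived from the uniform four-entry form. *)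
Lemma has_cspectrum_rcons0 (F : finFieldType) (f : F -> F) (c : F)
    (s : seq (nat * rat)) (i : nat) :
  has_cspectrum f c (rcons s (i, 0)) -> has_cspectrum f c s.
Proof.
move=> [sv s0]; split=> [j v js|j js].
  by apply: sv; rewrite mem_rcons inE js orbT.
have [->|ji] := eqVneq j i; last first.
  by apply: s0; rewrite /unzip1 map_rcons mem_rcons inE negb_or ji.
by apply/eqP; rewrite -(Num.Theory.eqr_nat rat) (sv i 0) // mem_rcons inE eqxx.
Qed.

Lemma sum_eqb (F : finFieldType) (a : F) (m : nat) :
  (\sum_b (b == a) * m = m)%N.
Proof.
by rewrite (bigD1 a) //= eqxx mul1n big1 ?addn0 // => b /negPf ->.
Qed.

(** * Quadratic character and roots of quadratics *)

Lemma quad_char_eq0 (F : finFieldType) (x : F) : (quad_char x == 0) = (x == 0).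
Proof. by rewrite /quad_char; case: (x == 0) => //; case: ifP. Qed.

Lemma quad_char_neq0 (F : finFieldType) (x : F) :
  x != 0 -> quad_char x = 1 \/ quad_char x = -1.
Proof. by move=> /negPf x0; rewrite /quad_char x0; case: ifP; [left|right]. Qed.

Lemma quad_charMsqr (F : finFieldType) (y x : F) :
  y != 0 -> quad_char (y ^+ 2 * x) = quad_char x.
Proof.
move=> y0; have y20 : y ^+ 2 != 0 by rewrite expf_eq0.
rewrite /quad_char mulf_eq0 (negPf y20) /=; case: eqP => // _.
congr (if _ then _ else _); apply/existsP/existsP => -[z /eqP xz].
  exists (z / y); rewrite -(inj_eq (mulfI y20)) xz -exprMn mulrCA divff //.
  by rewrite mulr1.
by exists (y * z); rewrite xz exprMn.
Qed.

(** Completing the square: multiplied by [4 * a], the equation says that [2 * a * x + b] is a square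
    root of the discriminant. *)
Lemma card_roots_quadratic (F : finFieldType) (a b c : F) :
    (2 : F) != 0 -> a != 0 ->
  #|[set x : F | a * x ^+ 2 + b * x + c == 0]|%:Z
    = 1 + quad_char (b ^+ 2 - 4 * a * c).
Proof.
move=> F2 a0; have a2 : 2 * a != 0 by rewrite mulf_neq0.
have a4 : 4 * a != 0 by rewrite (_ : 4 * a = 2 * (2 * a)) ?mulf_neq0 //; ring.
have rootE x : (a * x ^+ 2 + b * x + c == 0)
             = ((2 * a * x + b) ^+ 2 == b ^+ 2 - 4 * a * c).
  rewrite -subr_eq0 -(inj_eq (mulfI a4)) mulr0 -(subr_eq0 _ (b ^+ 2 - _)).
  by rewrite subr0; congr (_ == 0); ring.
have linE y x : (2 * a * x + b == y) = (x == (y - b) / (2 * a)).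
  rewrite -[RHS](inj_eq (mulIf a2)) divfK // [RHS]eq_sym subr_eq eq_sym.
  by congr (_ == _); ring.
rewrite /quad_char; case: eqP => [D0|/eqP D0].
  rewrite (_ : [set x | _] = [set - b / (2 * a)]) ?cards1 //.
  by apply/setP => x; rewrite !inE rootE D0 expf_eq0 /= linE sub0r.
case: existsP => [[y /eqP Dy]|nsq]; last first.
  rewrite (_ : [set x | _] = set0) ?cards0 ?subrr //.
  apply/setP => x; rewrite !inE rootE; apply/negP => /eqP sq.
  by case: nsq; exists (2 * a * x + b); rewrite sq.
have y0 : y != 0 by move: D0; rewrite Dy expf_eq0.
rewrite (_ : [set x | _] = [set (y - b) / (2 * a); (- y - b) / (2 * a)]).
  (* The two roots differ, since [y = - y] would force [2 * y = 0]. *)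
  rewrite cards2 (inj_eq (mulIf (invr_neq0 a2))) (inj_eq (addIr (- b))).
  by rewrite -addr_eq0 -mulr2n -mulr_natl mulf_eq0 (negPf F2) (negPf y0).
by apply/setP => x; rewrite !inE rootE Dy eqf_sqr !linE.
Qed.

(** As a polynomial in [b] this is monic quadratic with constant term [(1 - c) ^+ 2], and its own
    discriminant is [4 ^+ 2 * c], which has the character of [c]. *)
Lemma card_disc_eq0 (F : finFieldType) (c : F) : (2 : F) != 0 ->
  #|[set b : F | (b - c - 1) ^+ 2 - 4 * c == 0]|%:Z = 1 + quad_char c.
Proof.
move=> F2; have F4 : (4 : F) != 0 by rewrite (_ : 4 = 2 * 2) ?mulf_neq0 //; ring.
rewrite -(quad_charMsqr F _ c F4).
rewrite (_ : 4 ^+ 2 * c = (- 2 * (c + 1)) ^+ 2 - 4 * 1 * (1 - c) ^+ 2); last by ring.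
rewrite -card_roots_quadratic ?oner_neq0 //; congr (Posz _).
by apply: eq_card => b; rewrite !inE; congr (_ == 0); ring.
Qed.

(** * Solution counts and spectrum of the inverse map *)

Section InverseSpectrum.

Variables (F : finFieldType) (c : F).
Hypotheses (F2 : (2 : F) != 0) (c0 : c != 0) (c1 : c != 1).
Hypotheses (c4 : c != 4) (cV4 : c != 4^-1).

Let disc (b : F) : F := (b - c - 1) ^+ 2 - 4 * c.
Let delta (b : F) : nat := cdelta (@GRing.inv F) c 1 b.

Lemma F4_neq0 : (4 : F) != 0.
Proof. by rewrite (_ : 4 = 2 * 2) ?mulf_neq0 //; ring. Qed.

(* Valid at x = 0 and x = -1 too, thanks to 0^-1 = 0: the quadratic takes the
   nonzero values c and 1 there. *)
Lemma inv_equationE (x b : F) :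
  ((x + 1)^-1 - c * x^-1 == b) =
  ((b * x ^+ 2 + (b + c - 1) * x + c == 0)%R
   + (x == 0)%R * (b == 1)%R + (x == - 1)%R * (b == c))%N :> nat.
Proof.
have [->|x0] := eqVneq x 0.
  rewrite add0r invr0 invr1 mulr0 subr0 expr0n !mulr0 !add0r (negPf c0).
  by rewrite (eq_sym 0 (- 1)) oppr_eq0 oner_eq0 mul1n mul0n addn0 eq_sym.
have [->|x1] := eqVneq x (- 1).
  rewrite addNr invr0 invrN invr1 mulrN1 opprK add0r.
  rewrite (_ : b * _ + _ + _ = 1); last by ring.
  by rewrite oner_eq0 mul1n eq_sym.
have x1' : x + 1 != 0 by rewrite addr_eq0.
(* Both corrections vanish here; changing sign and clearing the denominator [x * (x + 1)] yields
   exactly the quadratic. *)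
rewrite !mul0n !addn0 -subr_eq0 -oppr_eq0.
rewrite -(inj_eq (mulfI (mulf_neq0 x0 x1'))) mulr0.
by congr (nat_of_bool (_ == 0)); field; rewrite x0.
Qed.

Lemma delta_invE (b : F) :
  (delta b)%:Z = (if b == 0 then 1 else 1 + quad_char (disc b))
                 + (b == 1)%:Z + (b == c)%:Z.
Proof.
have -> : delta b = (#|[set x | b * x ^+ 2 + (b + c - 1) * x + c == 0]%R|
                     + (b == 1%R) + (b == c))%N.
  rewrite /delta /cdelta -!sum1dep_card !(big_mkcond (fun x => _ == _)) /=.
  (* The corrections become sums over [x] concentrated at 0 and -1, so that [inv_equationE] applies
     termwise. *)
  rewrite -(sum_eqb F 0 (b == 1%R)) -(sum_eqb F (- 1) (b == c)) -!big_split /=.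
  by apply: eq_bigr => x _; move: (inv_equationE x b); do 2 case: ifP.
rewrite !PoszD; congr (_ + _ + _); case: eqP => [->|/eqP b0].
  (* At [b = 0] the equation degenerates to [(c - 1) * x + c = 0], with a single root as
     [c != 1]. *)
  rewrite (_ : [set x | _] = [set c / (1 - c)]) ?cards1 //.
  have c1' : 1 - c != 0 by rewrite subr_eq0 eq_sym.
  apply/setP => x; rewrite !inE -[RHS](inj_eq (mulIf c1')) divfK //.
  by rewrite -[RHS]subr_eq0 -[RHS]oppr_eq0; congr (_ == 0); ring.
rewrite card_roots_quadratic //; congr (1 + quad_char _); rewrite /disc; ring.
Qed.

Lemma disc0 : disc 0 != 0.
Proof.
rewrite /disc (_ : _ - _ = (1 - c) ^+ 2); last by ring.
by rewrite expf_eq0 subr_eq0 eq_sym.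
Qed.

Lemma disc1 : disc 1 = c ^+ 2 - 4 * c.
Proof. by rewrite /disc; ring. Qed.

Lemma discc : disc c = 1 - 4 * c.
Proof. by rewrite /disc; ring. Qed.

(** With [discc_neq0], this ensures that at [b = 1] and [b = c] the quadratic has 0 or 2 roots, so
    the extra solution there makes [delta b] equal to 1 or 3. *)
Lemma disc1_neq0 : c ^+ 2 - 4 * c != 0.
Proof. by rewrite expr2 -mulrBl mulf_neq0 // subr_eq0. Qed.

Lemma discc_neq0 : 1 - 4 * c != 0.
Proof.
apply: contra cV4; rewrite subr_eq0 => /eqP e.
by rewrite -(inj_eq (mulfI F4_neq0)) -e divff // F4_neq0.
Qed.

(** Two roots at most, plus at most one extra solution because [c != 1] keeps [b = 1] and [b = c]
    apart. *)
Lemma delta_inv_le3 (b : F) : (delta b <= 3)%N.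
Proof.
suff : (delta b)%:Z <= 3 by [].
rewrite delta_invE; have [->|b0] := eqVneq b 0.
  by rewrite (eq_sym 0 1) oner_eq0 eq_sym (negPf c0).
have q1 x : quad_char (disc x) <= 1.
  by rewrite /quad_char; case: ifP => // _; case: ifP.
have [->|b1] := eqVneq b 1; last by move: (q1 b); case: (b == c); lia.
by rewrite (eq_sym 1 c) (negPf c1); move: (q1 1); lia.
Qed.

(** The four terms never overlap, as [disc] is nonzero at 0, 1 and [c]: a double root, the linear
    case, or an extra solution without roots. The factor [* 1] gives the second term the shape of
    [sum_eqb]. *)
Lemma delta_inv_eq1 (b : F) :
  ((delta b == 1) =
  (disc b == 0)%R + (b == 0)%R * 1
   + (b == 1)%R * (quad_char (c ^+ 2 - 4 * c) == -1)%R
   + (b == c) * (quad_char (1 - 4 * c) == -1)%R :> nat)%N.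
Proof.
rewrite -eqz_nat delta_invE -disc1 -discc.
have [->|b0] := eqVneq b 0.
  by rewrite (negPf disc0) (eq_sym 0 1) oner_eq0 (eq_sym 0 c) (negPf c0).
have [->|b1] := eqVneq b 1.
  rewrite disc1 (eq_sym 1 c) (negPf c1) (negPf disc1_neq0).
  by have [->|->] := quad_char_neq0 _ _ disc1_neq0.
have [->|bc] := eqVneq b c.
  rewrite discc (negPf discc_neq0).
  by have [->|->] := quad_char_neq0 _ _ discc_neq0.
rewrite -quad_char_eq0; lia.
Qed.

Lemma delta_inv_eq3 (b : F) :
  ((delta b == 3) =
  (b == 1)%R * (quad_char (c ^+ 2 - 4 * c) == 1)%R
   + (b == c) * (quad_char (1 - 4 * c) == 1)%R :> nat)%N.
Proof.
rewrite -eqz_nat delta_invE -disc1 -discc.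
have [->|b0] := eqVneq b 0.
  by rewrite (eq_sym 0 1) oner_eq0 (eq_sym 0 c) (negPf c0).
have [->|b1] := eqVneq b 1.
  rewrite disc1 (eq_sym 1 c) (negPf c1).
  by have [->|->] := quad_char_neq0 _ _ disc1_neq0.
have [->|bc] := eqVneq b c.
  rewrite discc.
  by have [->|->] := quad_char_neq0 _ _ discc_neq0.
by rewrite /quad_char; case: ifP => // _; case: ifP.
Qed.

Lemma comega_inv1 :
  (comega (@GRing.inv F) c 1)%:Z =
  2 + quad_char c + (quad_char (c ^+ 2 - 4 * c) == -1)%:Z
    + (quad_char (1 - 4 * c) == -1)%:Z.
Proof.
rewrite comegaE (eq_bigr _ (fun b _ => delta_inv_eq1 b)) !big_split /= !sum_eqb.
(* One unit of the 2 comes from [b = 0], the other from the count [1 + quad_char c] of zeros of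
   [disc]. *)
rewrite !PoszD; congr (_ + _ + _); rewrite (_ : 2 = 1 + 1) // addrAC.
rewrite -card_disc_eq0 //; congr (Posz _ + _).
rewrite -sum1dep_card [RHS]big_mkcond /=.
by apply: eq_bigr => b _; rewrite /disc; case: ifP.
Qed.

Lemma comega_inv3 :
  comega (@GRing.inv F) c 3 =
  ((quad_char (c ^+ 2 - 4 * c) == 1)%R + (quad_char (1 - 4 * c) == 1)%R)%N.
Proof.
by rewrite comegaE (eq_bigr _ (fun b _ => delta_inv_eq3 b)) big_split /= !sum_eqb.
Qed.

Lemma comega_inv_gt3 (j : nat) : (3 < j)%N -> comega (@GRing.inv F) c j = 0%N.
Proof.
move=> j3; rewrite comegaE big1 // => b _; apply/eqP; rewrite eqb0.
by rewrite ltn_eqF // (leq_ltn_trans (delta_inv_le3 b)).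
Qed.

(** The entries for 0 and 2 solve the linear system of [comega_sums] with [w1] and [w3] as
    parameters. *)
Lemma has_cspectrum_inv (q : rat) (w1 w3 : nat) :
    #|F|%:R = q ->
    comega (@GRing.inv F) c 1 = w1 -> comega (@GRing.inv F) c 3 = w3 ->
  has_cspectrum (@GRing.inv F) c
    [:: (0%N, (q - w1%:R + w3%:R) / 2); (1%N, w1%:R);
        (2%N, (q - w1%:R - 3 * w3%:R) / 2); (3%N, w3%:R)].
Proof.
move=> <- <- <-; have [sum_w sum_iw] := comega_sums _ _ _ delta_inv_le3.
move: sum_w sum_iw => /(congr1 (fun m => m%:R : rat)) + /(congr1 (fun m => m%:R : rat)).
rewrite !natrD => sum_w sum_iw; split=> [i v|j].
  by rewrite !inE => /or4P[] /eqP[-> ->] //; lra.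
by case: j => [|[|[|[|j]]]] // _; apply: comega_inv_gt3.
Qed.

End InverseSpectrum.

Theorem theorem8 (p n : nat) (F : finFieldType) (c : F)
    (p_prime : prime p) (p_odd : odd p) (n_gt0 : (0 < n)%N)
    (cardF : #|F| = (p ^ n)%N)
    (c_neq0 : c != 0) (c_neq1 : c != 1) (c_neq4 : c != 4) (c_neqV4 : c != 4^-1) :
  let f := fun x : F => x ^+ (p ^ n - 2)%N in
  let q : rat := (p ^ n)%:R in
  let chi := @quad_char F in
  (* (i) *)
  (chi (c ^+ 2 - 4 * c) = -1 -> chi (1 - 4 * c) = -1 -> chi c = -1 ->
    has_cspectrum f c
      [:: (0%N, (q - 3) / 2); (1%N, 3); (2%N, (q - 3) / 2)]) /\
  (* (ii) *)
  (chi (c ^+ 2 - 4 * c) = -1 -> chi (1 - 4 * c) = -1 -> chi c = 1 ->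
    has_cspectrum f c
      [:: (0%N, (q - 5) / 2); (1%N, 5); (2%N, (q - 5) / 2)]) /\
  (* (iii) *)
  (chi (c ^+ 2 - 4 * c) * chi (1 - 4 * c) = -1 -> chi c = -1 ->
    has_cspectrum f c
      [:: (0%N, (q - 1) / 2); (1%N, 2); (2%N, (q - 5) / 2); (3%N, 1)]) /\
  (* (iv) *)
  (chi (c ^+ 2 - 4 * c) * chi (1 - 4 * c) = -1 -> chi c = 1 ->
    has_cspectrum f c
      [:: (0%N, (q - 3) / 2); (1%N, 4); (2%N, (q - 7) / 2); (3%N, 1)]) /\
  (* (v) *)
  (chi (c ^+ 2 - 4 * c) = 1 -> chi (1 - 4 * c) = 1 -> chi c = -1 ->
    has_cspectrum f c
      [:: (0%N, (q + 1) / 2); (1%N, 1); (2%N, (q - 7) / 2); (3%N, 2)]) /\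
  (* (vi) *)
  (chi (c ^+ 2 - 4 * c) = 1 -> chi (1 - 4 * c) = 1 -> chi c = 1 ->
    has_cspectrum f c
      [:: (0%N, (q - 1) / 2); (1%N, 3); (2%N, (q - 9) / 2); (3%N, 2)]).
Proof.
move=> f q; rewrite /=.
have F2 : (2 : F) != 0.
  have pF := card_finPcharP cardF p_prime.
  rewrite -(dvdn_pcharf pF) dvdn_prime2 //.
  by apply: contraL p_odd => /eqP ->.
have q_ge2 : (2 <= p ^ n)%N.
  rewrite -(prednK n_gt0) expnS (leq_trans (prime_gt1 p_prime)) //.
  by rewrite leq_pmulr // expn_gt0 prime_gt0.
have q_odd : odd (p ^ n) by rewrite oddX p_odd orbT.
(* This makes the exponent [p ^ n - 2] positive, so the power map sends 0 to 0, in agreement with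
   [0^-1 = 0]. *)
have q_ge3 : (2 < p ^ n)%N.
  by rewrite ltn_neqAle q_ge2 andbT; apply: contraL q_odd => /eqP <-.
have fV : f =1 @GRing.inv F.
  move=> x; rewrite /f; have [->|x0] := eqVneq x 0.
    by rewrite expr0n invr0 subn_eq0 leqNgt q_ge3.
  (* Multiplied by [x ^+ 2], both sides equal [x], the left one by [x ^+ #|F| = x]. *)
  apply: (mulIf (expf_neq0 2 x0)); rewrite -exprD subnK // -cardF expf_card.
  by rewrite expr2 mulKf.
have specE s : has_cspectrum (@GRing.inv F) c s -> has_cspectrum f c s.
  have omE j : comega f c j = comega (@GRing.inv F) c j.
    by rewrite !comegaE; apply: eq_bigr => b _; rewrite (eq_cdelta _ f _ c 1 b fV).
  by move=> [h1 h2]; split=> [i v|j] h; rewrite omE; [apply: h1 | apply: h2].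
have w1 := comega_inv1 F c F2 c_neq0 c_neq1 c_neq4 c_neqV4.
have w3 := comega_inv3 F c F2 c_neq0 c_neq1 c_neq4 c_neqV4.
have spec a b v0 v2 :
    comega (@GRing.inv F) c 1 = a -> comega (@GRing.inv F) c 3 = b ->
    v0 = (q - a%:R + b%:R) / 2 -> v2 = (q - a%:R - 3 * b%:R) / 2 ->
    has_cspectrum f c [:: (0%N, v0); (1%N, a%:R); (2%N, v2); (3%N, b%:R)].
  move=> wa wb -> ->; apply: specE; apply: has_cspectrum_inv => //.
  by rewrite cardF.
(* A product -1 means one character is 1 and the other -1; only these counts enter [w1] and [w3], so
   which is which does not matter. *)
have chiM : quad_char (c ^+ 2 - 4 * c) * quad_char (1 - 4 * c) = -1 ->
    (quad_char (c ^+ 2 - 4 * c) == -1)%:Z + (quad_char (1 - 4 * c) == -1)%:Z = 1 /\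
    ((quad_char (c ^+ 2 - 4 * c) == 1)%R + (quad_char (1 - 4 * c) == 1)%R = 1)%N.
  by have [->|->] := quad_char_neq0 F _ (disc1_neq0 F c c_neq0 c_neq4);
     have [->|->] := quad_char_neq0 F _ (discc_neq0 F c F2 c_neqV4).
(* In order, the six cases have (omega_1, omega_3) = (3, 0), (5, 0), (2, 1), (4, 1), (1, 2), (3, 2),
   read off from [w1] and [w3]. *)
split=> [A B C|].
  apply: (has_cspectrum_rcons0 _ _ _ _ 3); rewrite /=.
  by apply: (spec 3 0)%N; [move: w1; rewrite A B C; lia | rewrite w3 A B | lra | lra].
split=> [A B C|].
  apply: (has_cspectrum_rcons0 _ _ _ _ 3); rewrite /=.
  by apply: (spec 5 0)%N; [move: w1; rewrite A B C; lia | rewrite w3 A B | lra | lra].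
split=> [/chiM[A B] C|].
  by apply: (spec 2 1)%N; [move: w1; rewrite -addrA A C; lia | rewrite w3 B | lra | lra].
split=> [/chiM[A B] C|].
  by apply: (spec 4 1)%N; [move: w1; rewrite -addrA A C; lia | rewrite w3 B | lra | lra].
split=> [A B C|A B C].
  by apply: (spec 1 2)%N; [move: w1; rewrite A B C; lia | rewrite w3 A B | lra | lra].
by apply: (spec 3 2)%N; [move: w1; rewrite A B C; lia | rewrite w3 A B | lra | lra].
Qed.
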